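(* Let $L_1,L_2$ be a pair of orthogonal Latin squares of order $n$. Then $(L_1,L_2)$ is a cooperative pair (of order $n\times n$), and therefore the Mealy automaton encoded by the matched matrices $(C,R)=(L_1,L_2)$ is bireversible.
   Context: $[n]=\{1,\dots,n\}$. A Latin square of order $n$ is an $n\times n$ matrix with entries in $[n]$ in which every element of $[n]$ appears exactly once in each row and in each column. Latin squares $L_1,L_2$ of order $n$ are orthogonal if every element of $[n]\times[n]$ appears exactly once among the pairs $(L_1(i,j),L_2(i,j))$. A pair $(C,R)$ of $m\times n$ matrices, $C$ with entries in $[m]$ and $R$ with entries in $[n]$, is a cooperative pair if every element of $[m]$ appears exactly once in each column of $C$, every element of $[n]$ appears exactly once in each row of $R$, and every element of $[m]\times[n]$ appears exactly once among the pairs $(C(i,j),R(i,j))$. The Mealy automaton encoded by such a pair has state set $[m]$, alphabet $[n]$, transition function $\pi(i,j)=C(i,j)$ and output function $\lambda(i,j)=R(i,j)$. Its transition set is $E=\{(i,j,\pi(i,j),\lambda(i,j))\}$. A Mealy automaton with states $Q$, letters $X$ and transition set $E$ is bireversible if for all $q\in Q,y\in X$ exactly one element of $E$ has the form $(q,\cdot,\cdot,y)$ (invertible), for all $x\in X,r\in Q$ exactly one has the form $(\cdot,x,r,\cdot)$ (reversible), and for all $r\in Q,y\in X$ exactly one has the form $(\cdot,\cdot,r,y)$ (coreversible). *)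

(* Defs.v *)
From mathcomp Require Import all_boot all_order all_algebra.

Set Implicit Arguments.
Unset Strict Implicit.
Unset Printing Implicit Defensive.

(* The set [n] = {1, ..., n} is represented by 'I_n = {0, ..., n-1}. *)

Definition latin_square (n : nat) (L : 'M['I_n]_n) : Prop :=
  (forall i a : 'I_n, exists! j : 'I_n, L i j = a) /\
  (forall j a : 'I_n, exists! i : 'I_n, L i j = a).

Definition orthogonal_squares (n : nat) (L1 L2 : 'M['I_n]_n) : Prop :=
  forall ab : 'I_n * 'I_n,
    exists! ij : 'I_n * 'I_n, (L1 ij.1 ij.2, L2 ij.1 ij.2) = ab.

Definition cooperative_pair (m n : nat)
    (C : 'M['I_m]_(m, n)) (R : 'M['I_n]_(m, n)) : Prop :=
  [/\ forall (j : 'I_n) (a : 'I_m), exists! i : 'I_m, C i j = a,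
      forall (i : 'I_m) (b : 'I_n), exists! j : 'I_n, R i j = b
    & forall ab : 'I_m * 'I_n,
        exists! ij : 'I_m * 'I_n, (C ij.1 ij.2, R ij.1 ij.2) = ab].

Record mealy (Q X : finType) := Mealy {
  mealy_trans : Q -> X -> Q;
  mealy_out : Q -> X -> X
}.

Section Mealy.

Variables Q X : finType.

(* (q, x, r, y): in state q, reading x, move to state r and write y. *)
Definition transition : finType := (Q * X * Q * X)%type.

Definition t_source (t : transition) : Q := t.1.1.1.
Definition t_input (t : transition) : X := t.1.1.2.
Definition t_target (t : transition) : Q := t.1.2.
Definition t_output (t : transition) : X := t.2.

Definition transition_set (A : mealy Q X) : {set transition} :=
  [set (q, x, mealy_trans A q x, mealy_out A q x) | q : Q, x : X].

Definition invertible (A : mealy Q X) : Prop :=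
  forall (q : Q) (y : X), exists! t : transition,
    [/\ t \in transition_set A, t_source t = q & t_output t = y].

Definition reversible (A : mealy Q X) : Prop :=
  forall (x : X) (r : Q), exists! t : transition,
    [/\ t \in transition_set A, t_input t = x & t_target t = r].

Definition coreversible (A : mealy Q X) : Prop :=
  forall (r : Q) (y : X), exists! t : transition,
    [/\ t \in transition_set A, t_target t = r & t_output t = y].

Definition bireversible (A : mealy Q X) : Prop :=
  [/\ invertible A, reversible A & coreversible A].

End Mealy.

Definition encoded_mealy (m n : nat)
    (C : 'M['I_m]_(m, n)) (R : 'M['I_n]_(m, n)) : mealy 'I_m 'I_n :=
  Mealy (fun i j => C i j) (fun i j => R i j).

(* Main.v *)
Require Import Defs.
From mathcomp Require Import all_boot all_order all_algebra.

(** A transition is determined by its source and input, so transitions correspond to matrix cells,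
    the cell [(i, j)] giving [(i, j, C i j, R i j)] ([transition_setP]). Prescribing two coordinates
    of a transition thus becomes a condition on cells, and [cooperative_bireversible] matches the
    three resulting conditions with the clauses of a cooperative pair. *)

Lemma transition_setP (Q X : finType) (A : mealy Q X) (t : transition Q X) :
  reflect (t_target t = mealy_trans A (t_source t) (t_input t) /\
           t_output t = mealy_out A (t_source t) (t_input t))
          (t \in transition_set A).
Proof.
apply: (iffP imset2P) => [[q x _ _ ->] // |].
case: t => [[[q x] r] y]; rewrite /t_target /t_output /t_source /t_input /=.
by case=> -> ->; exists q x.
Qed.

(** Invertibility locates a letter in a row of [R], reversibility a state in a column of [C],
    coreversibility the cell carrying a given pair. *)
Lemma cooperative_bireversible (m n : nat)
    (C : 'M['I_m]_(m, n)) (R : 'M['I_n]_(m, n)) :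
  cooperative_pair C R -> bireversible (encoded_mealy C R).
Proof.
case=> colC rowR pairCR; split.
- move=> q y; have [j [Rqj uniq_j]] := rowR q y.
  exists (q, j, C q j, y); split.
    by split=> //; apply/transition_setP; split=> //=.
  (* A competitor's input solves the same equation in row [q], so it equals [j]; its target is then
     forced. *)
  case=> [[[q' j'] r] y'] [/transition_setP[/= tr out]].
  rewrite /t_source /t_output /t_target /t_input /= in tr out * => eq_q eq_y.
  by subst; rewrite -(uniq_j j').
- move=> x r; have [i [Cix uniq_i]] := colC x r.
  exists (i, x, r, R i x); split.
    by split=> //; apply/transition_setP; split=> //=.
  case=> [[[i' x'] r'] y] [/transition_setP[/= tr out]].
  rewrite /t_source /t_output /t_target /t_input /= in tr out * => eq_x eq_r.
  by subst; rewrite -(uniq_i i').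
- move=> r y; have [[i j] [/= [Cij Rij] uniq_ij]] := pairCR (r, y).
  exists (i, j, r, y); split.
    by split=> //; apply/transition_setP; split=> //=.
  case=> [[[i' j'] r'] y'] [/transition_setP[/= tr out]].
  rewrite /t_source /t_output /t_target /t_input /= in tr out * => eq_r eq_y.
  (* Here source and input are both unknown, so uniqueness must be applied to the whole cell. *)
  have CR' : (C i' j', R i' j') = (r, y) by rewrite -tr -out eq_r eq_y.
  by have [-> ->] := uniq_ij (i', j') CR'; rewrite eq_r eq_y.
Qed.

Theorem proposition1p4 (n : nat) (L1 L2 : 'M['I_n]_n)
    (hL1 : latin_square L1) (hL2 : latin_square L2)
    (horth : orthogonal_squares L1 L2) :
  cooperative_pair L1 L2 /\ bireversible (encoded_mealy L1 L2).
Proof.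
(* Columns of [L1], rows of [L2] and orthogonality supply the three clauses. *)
have coop : cooperative_pair L1 L2 by split; [exact: hL1.2 | exact: hL2.1 |].
by split=> //; apply: cooperative_bireversible.
Qed.
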